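(* Let $m,n\ge 1$, and let $\alpha$ and $\beta$ be standard Young tableaux of shape $n^m$ and $m^n$ respectively. Then there is an integer $\kappa_{\alpha,\beta}$ (depending only on $\alpha,\beta$) such that for every commutative ring $R$, every $mn\times m$ matrix $A$ and every $mn\times n$ matrix $B$ with entries in $R$, $$\kappa_{\alpha,\beta}\,\det(A\star B)=\sum_{\sigma\in\Sigma_{mn}}\varepsilon(\sigma)\,A_{\sigma\alpha}\,B_{\sigma\beta},$$ where $\Sigma_{mn}$ is the symmetric group on $\{1,\ldots,mn\}$ and $\varepsilon(\sigma)$ is the sign of $\sigma$. The integer $\kappa_{\alpha,\beta}$ vanishes if and only if $\langle\alpha,\beta\rangle=0$. Moreover, when $\alpha=1_{n^m}$ and $\beta$ is the conjugate of $1_{n^m}$, then for $m\ge n$, $$\kappa_{\alpha,\beta}=H_{m,n}=\prod_{i=0}^{n-1}\frac{(m+i)!}{i!},$$ which is the product of the hook lengths of the Young diagram of shape $n^m$.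
   Context: Amalgam. Let $\underline{a}_i\in R^m$ and $\underline{b}_i\in R^n$ denote the $i$-th rows of $A$ and $B$. Then $A\star B$ is the $mn\times mn$ matrix whose $i$-th row is the Kronecker product $\underline{a}_i\otimes\underline{b}_i$, with the convention $$(a_1,\ldots,a_m)\otimes(b_1,\ldots,b_n)=(a_1b_1,a_2b_1,\ldots,a_mb_1,\ a_1b_2,\ldots,a_mb_2,\ \ldots,\ a_1b_n,\ldots,a_mb_n).$$ Tableaux. The shape $n^m=(n,\ldots,n)$ has $m$ rows and $n$ columns; $m^n$ has $n$ rows and $m$ columns. A tableau of a given shape with $mn$ boxes is a filling by $1,\ldots,mn$, each used once; it is standard if all rows increase from left to right and all columns increase from top to bottom. The conjugate $\gamma'$ of a tableau $\gamma$ is its transpose. Two tableaux are column-equivalent if they differ only by permuting elements within each column. For $\sigma\in\Sigma_{mn}$, $\sigma\gamma$ is the tableau obtained from $\gamma$ by replacing each entry $l$ by $\sigma(l)$. $1_{n^m}$ is the tableau of shape $n^m$ with $1,\ldots,mn$ placed consecutively down the first column, then down the second, etc. For a tableau $\gamma$ of shape $n^m$, $\varepsilon(\gamma)$ is the sign of the unique permutation $\pi$ with $\pi 1_{n^m}=\gamma$. Products of minors. For any (not necessarily standard) tableau $\gamma$ of shape $n^m$, $A_\gamma=\prod_{i=1}^n\det A_{\mathrm{col}_i(\gamma)}$, where $A_{\mathrm{col}_i(\gamma)}$ is the $m\times m$ matrix whose successive rows are the rows $\underline{a}_l$ of $A$ with $l$ running through the entries of the $i$-th column of $\gamma$ in order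 from top to bottom. For any tableau $\delta$ of shape $m^n$, $B_\delta=\prod_{j=1}^m\det B_{\mathrm{col}_j(\delta)}$ is defined in the same way from the rows of $B$ and the columns of $\delta$. Fayers number. For $\alpha$ standard of shape $n^m$ and $\beta$ standard of shape $m^n$, $\langle\alpha,\beta\rangle=0$ if there are two distinct numbers lying in a common column of $\alpha$ and in a common column of $\beta$; otherwise there is a unique tableau $\gamma$ of shape $n^m$ such that $\gamma$ is column-equivalent to $\alpha$ and $\gamma'$ is column-equivalent to $\beta$, and $\langle\alpha,\beta\rangle=\varepsilon(\gamma)\in\{-1,1\}$. *)

(* Defs.v *)
From mathcomp Require Import all_boot all_order all_fingroup all_algebra.

Set Implicit Arguments.
Unset Strict Implicit.
Unset Printing Implicit Defensive.

Import GRing.Theory.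
Local Open Scope ring_scope.

(* Rows, columns, boxes and entries are numbered from 0, so the entries       *)
(* 1, ..., mn of the paper are the elements 0, ..., mn - 1 of 'I_(m * n).     *)
(* A filling of the r x c box diagram is a matrix with entries in 'I_N; its   *)
(* conjugate is its transpose g^T, and sigma g is map_mx sigma g.             *)

Section Positions.
Variables m n : nat.

Lemma pos_subproof (i : 'I_m) (j : 'I_n) : (j * m + i < m * n)%N.
Proof.
apply: (@leq_trans (j * m + m)); first by rewrite ltn_add2l.
by rewrite -mulSnr mulnC leq_mul2l ltn_ord orbT.
Qed.

Lemma pos_row_subproof (k : 'I_(m * n)) : (k %% m < m)%N.
Proof. by rewrite ltn_mod; case: m k => // -[]. Qed.

Lemma pos_col_subproof (k : 'I_(m * n)) : (k %/ m < n)%N.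
Proof.
have m_gt0 : (0 < m)%N by case: m k => // -[].
by rewrite ltn_divLR // [X in (_ < X)%N]mulnC ltn_ord.
Qed.

(* Column-by-column numbering of the boxes of an m x n diagram, and the       *)
(* row and column of the k-th box.                                            *)
Definition pos (i : 'I_m) (j : 'I_n) : 'I_(m * n) := Ordinal (pos_subproof i j).
Definition pos_row (k : 'I_(m * n)) : 'I_m := Ordinal (pos_row_subproof k).
Definition pos_col (k : 'I_(m * n)) : 'I_n := Ordinal (pos_col_subproof k).

End Positions.

Section Amalgam.
Variables (R : comPzRingType) (m n : nat).

(* (a_1 b_1, ..., a_m b_1, a_1 b_2, ..., a_m b_2, ...): the index of a varies *)
(* fastest, contrary to the row-major order of mxvec.                         *)
Definition kron_row (a : 'rV[R]_m) (b : 'rV[R]_n) : 'rV[R]_(m * n) :=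
  \row_k (a 0 (pos_row k) * b 0 (pos_col k)).

Definition amalgam (A : 'M[R]_(m * n, m)) (B : 'M[R]_(m * n, n)) :
    'M[R]_(m * n) :=
  \matrix_(i < m * n) kron_row (row i A) (row i B).

End Amalgam.

Section Tableaux.
Variables N r c : nat.
Implicit Types g d : 'M['I_N]_(r, c).

(* every number is used exactly once (hence N = r * c) *)
Definition is_tableau g : bool :=
  [forall l : 'I_N, #|[set b : 'I_r * 'I_c | g b.1 b.2 == l]| == 1%N].

Definition is_standard g : bool :=
  [&& is_tableau g,
      [forall i : 'I_r, forall j1 : 'I_c, forall j2 : 'I_c,
         (j1 < j2)%N ==> (g i j1 < g i j2)%N]
    & [forall j : 'I_c, forall i1 : 'I_r, forall i2 : 'I_r,
         (i1 < i2)%N ==> (g i1 j < g i2 j)%N]].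

Definition col_equiv g d : bool :=
  [forall j : 'I_c, exists s : 'S_r, col j g == row_perm s (col j d)].

Definition in_common_col g (k l : 'I_N) : bool :=
  [exists j : 'I_c, [exists i, g i j == k] && [exists i, g i j == l]].

Definition tab_minors (R : comPzRingType) (A : 'M[R]_(N, r)) g : R :=
  \prod_(j < c) \det (rowsub (fun i => g i j) A).

End Tableaux.

Section Fayers.
Variables m n : nat.

(* the tableau written 1_{n^m} in the paper *)
Definition first_tab : 'M['I_(m * n)]_(m, n) := \matrix_(i, j) pos i j.

(* The value 0 is never used when g is a tableau. *)
Definition tab_sign (g : 'M['I_(m * n)]_(m, n)) : int :=
  if [pick p : 'S_(m * n) | map_mx p first_tab == g] is Some p
  then (-1) ^+ p else 0.

(* When alpha and beta are tableaux and the first test fails, exactly one     *)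
(* matrix satisfies the condition in the [pick], so the last 0 is never used. *)
Definition fayers (alpha : 'M['I_(m * n)]_(m, n))
                  (beta : 'M['I_(m * n)]_(n, m)) : int :=
  if [exists k, exists l,
        [&& k != l, in_common_col alpha k l & in_common_col beta k l]]
  then 0
  else if [pick g : 'M['I_(m * n)]_(m, n) |
             [&& is_tableau g, col_equiv g alpha & col_equiv g^T beta]]
       is Some g then tab_sign g else 0.

Definition hook_const : rat :=
  \prod_(i < n) ((m + i)`!%:R / (i`!)%:R).

(* number of boxes of the m x n diagram weakly right of (i, j) in row i or    *)
(* weakly below it in column j                                                *)
Definition hook_length (i : 'I_m) (j : 'I_n) : nat :=
  #|[set b : 'I_m * 'I_n | ((b.1 == i) && (j <= b.2)%N)
                        || ((b.2 == j) && (i <= b.1)%N)]|.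

End Fayers.

(* Main.v *)
From HB Require Import structures.
Require Import Defs.
From mathcomp Require Import all_boot all_order all_fingroup all_algebra.
From mathcomp Require Import ssrcomplements mpoly ring zify.

Set Implicit Arguments.
Unset Strict Implicit.
Unset Printing Implicit Defensive.

Import GRing.Theory Num.Theory.
Local Open Scope ring_scope.

(** The signed sum over sigma is an alternating multilinear function of the
rows of the amalgam, which is why it is a multiple of its determinant; the
content of the theorem is the value of the multiple.

If two numbers k, l share a column in alpha and also in beta, then composing
sigma with the transposition (k l) changes the sign of all three factors of
the summand, so the sum cancels in pairs and kappa = 0.  Otherwise the columns
of alpha and beta meet in single entries, and these entries form a tableau
gamma with gamma column-equivalent to alpha and its conjugate to beta.
Reordering columns changes minors by signs only, and gamma is a relabelling
of the first tableau, so kappa is, up to sign, the constant [kappa_first] of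
the first tableau.  Everything therefore rests on computing [kappa_first] and
seeing that it is not zero.

A product of determinants of the blocks of a block-diagonal matrix is a single
Leibniz sum over the permutations preserving the blocks ([prod_det_perm]).
Expanding A_sigma over the column-preserving permutations p of the boxes and
B_sigma over the row-preserving permutations q gives [kappa_firstE], with
[kappa_first] the signed sum over p and q of the determinant of the 0-1 matrix
of the map sending a box k to (row of p k, column of q k).  This map is q
followed by a map that preserves columns, so its determinant is sign q times a
signed sum over column-preserving p' with row (p' (q k)) = row (p k) for all k.
What remains is the sum, over pairs p, p' of column-preserving permutations, of
sign p * sign p' times the number of row-preserving q matching p with p'.

The same number appears in the algebra of polynomials in the entries x_ij of a
generic m x m matrix X.  Let <f, g> be the constant term of f(d/dx) g.  The
pairing of two products of variables counts the bijections matching equal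
variables ([fischer_prodX]); expanding (det X)^n as above shows that
[kappa_first] = <(det X)^n, (det X)^n>.  By Cayley's identity
  det(d/dx) (det X)^s = s (s+1) ... (s+m-1) (det X)^(s-1)
this is the product of the (i+1)(i+2)...(i+m) for i < n, that is H_{m,n}, and
in particular it is positive.  Cayley's identity is proved by applying the
minors of d/dx on the first k rows, one more row at a time
([fischer_head_minor]): differentiating (det X)^s along those rows replaces the
rows of one factor det X by unit vectors, and the exchange relation for a
product of two determinants ([det_exchange]) recombines the terms. *)

(** * Determinants of block-diagonal matrices *)

Lemma det_castmx (R : comPzRingType) a b (e : a = b) (A : 'M[R]_a) :
  \det (castmx (e, e) A) = \det A.
Proof. by case: b / e; rewrite castmx_id. Qed.

Lemma det_mxdiag (R : comPzRingType) n (p : 'I_n -> nat)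
    (F : forall i, 'M[R]_(p i)) :
  \det (\mxdiag_i F i) = \prod_i \det (F i).
Proof.
elim: n p F => [|n IHn] p F.
  have det_size0 k (M : 'M[R]_k) : k = 0%N -> \det M = 1.
    by case: k M => // M _; rewrite det_mx00.
  by rewrite [RHS]big_ord0 det_size0 // big_ord0.
by rewrite mxdiag_recl det_castmx det_lblock big_ord_recl IHn.
Qed.

Lemma det_mxsub_bij (R : comPzRingType) a b (f : 'I_a -> 'I_b) (M : 'M[R]_b) :
  bijective f -> \det (mxsub f f M) = \det M.
Proof.
move=> f_bij; have ab : a = b by rewrite -[a]card_ord -[b]card_ord (bij_eq_card f_bij).
case: b / ab f f_bij M => f f_bij M; pose s := perm (bij_inj f_bij).
have -> : mxsub f f M = row_perm s (col_perm s M).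
  by apply/matrixP=> i j; rewrite !mxE !permE.
by rewrite row_permE col_permE !det_mulmx !det_perm mulrCA mulrA
           -mulrA odd_permV -signr_addb addbb mulr1.
Qed.

(** The functions f and g give the position of an index inside its block and
the block it lies in; any numbering of the pairs is allowed, since the
determinant is unchanged when rows and columns are renumbered alike. *)
Lemma det_blockwise (R : comPzRingType) N r c (f : 'I_N -> 'I_r) (g : 'I_N -> 'I_c)
    (F : 'I_c -> 'M[R]_r) :
  bijective (fun k => (f k, g k)) ->
  \det (\matrix_(k < N, l < N) ((g k == g l)%:R * F (g k) (f k) (f l)))
    = \prod_j \det (F j).
Proof.
case=> h hK Kh; rewrite -det_mxdiag.
pose e (s : 'I_(\sum_(j < c) r)) := h (tagnat.sig2 s, tagnat.sig1 s).
have e_bij : bijective e.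
  exists (fun k => @tagnat.Rank c (fun=> r) (g k) (f k)) => [s|k].
    have := Kh (tagnat.sig2 s, tagnat.sig1 s); rewrite -/(e s) => -[-> ->].
    exact: tagnat.sig2K.
  rewrite -[RHS]hK; congr h; rewrite tagnat.Rank1K; congr (_, _).
  by apply: val_inj; rewrite tagnat.Rank2K.
rewrite -(det_mxsub_bij _ e_bij); congr (\det _); apply/matrixP => s t.
rewrite !mxE.
have [-> ->] := Kh (tagnat.sig2 s, tagnat.sig1 s).
have [-> ->] := Kh (tagnat.sig2 t, tagnat.sig1 t).
rewrite /tagnat.sig1 /tagnat.sig2.
case: (tagnat.sig s) (tagnat.sig t) => [/= i j] [/= i' j'].
by case: eqP => _; rewrite ?conform_mx_id ?mul1r // mxE mul0r.
Qed.

(** The Leibniz sum of a block-diagonal matrix only sees the permutations that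
preserve the blocks.  A family of permutations, one for each block, and the
product of their signs are thus replaced by one permutation and its sign. *)
Lemma prod_det_perm (R : comPzRingType) N r c (f : 'I_N -> 'I_r) (g : 'I_N -> 'I_c)
    (F : 'I_c -> 'M[R]_r) :
  bijective (fun k => (f k, g k)) ->
  \prod_j \det (F j) = \sum_(s : 'S_N | [forall k, g (s k) == g k])
     (-1) ^+ s * \prod_k F (g k) (f k) (f (s k)).
Proof.
move=> fg_bij; rewrite -(det_blockwise _ fg_bij) [RHS]big_mkcond /=.
apply: eq_bigr => s _; case: forallP => [gs|ngs].
  by congr (_ * _); apply: eq_bigr => k _; rewrite mxE (eqP (gs k)) eqxx mul1r.
suff [k gk] : exists k, g (s k) != g k.
  by rewrite (bigD1 k) //= mxE eq_sym (negbTE gk) mul0r mul0r mulr0.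
by apply/existsP; rewrite -negb_forall; apply/negP => /forallP.
Qed.

(** * Replacing one row of a matrix *)

Lemma det_row_perm (R : comPzRingType) m (s : 'S_m) (A : 'M[R]_m) :
  \det (row_perm s A) = (-1) ^+ s * \det A.
Proof. by rewrite row_permE det_mulmx det_perm. Qed.

Lemma det_col_perm (R : comPzRingType) m (s : 'S_m) (A : 'M[R]_m) :
  \det (col_perm s A) = (-1) ^+ s * \det A.
Proof. by rewrite col_permE det_mulmx det_perm odd_permV mulrC. Qed.

Section RowReplacement.
Variables (R : comPzRingType) (m : nat).
Implicit Types A B : 'M[R]_m.

Definition set_row A (k : 'I_m) (v : 'I_m -> R) : 'M[R]_m :=
  \matrix_(a, c) if a == k then v c else A a c.

Lemma det_set_row A k v : \det (set_row A k v) = \sum_c v c * cofactor A k c.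
Proof.
rewrite (expand_det_row _ k); apply: eq_bigr => c _; rewrite mxE eqxx.
congr (_ * (_ * \det _)); apply/matrixP => a b.
by rewrite !mxE eq_sym (negbTE (neq_lift _ _)).
Qed.

Lemma cofactor_set_row A k j :
  cofactor A k j = \det (set_row A k (fun c => (c == j)%:R)).
Proof.
rewrite det_set_row (bigD1 j) //= eqxx mul1r big1 ?addr0 // => c /negbTE ->.
by rewrite mul0r.
Qed.

(** Each factor of the sum is linear in the row brought in, with cofactors as
coefficients, so the sum is an entry of A adj(B) B adj(A), and two applications
of Cramer's rule evaluate it. *)
Lemma det_exchange A B k :
  \sum_b (\det (set_row A k (B b))) * \det (set_row B b (A k)) = \det A * \det B.
Proof.
have -> : \det A * \det B = ((A *m (\adj B *m B)) *m \adj A) k k.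
  by rewrite mul_adj_mx mul_mx_scalar -scalemxAl mul_mx_adj !mxE eqxx mulrC.
rewrite mulmxA -mulmxA !mxE; apply: eq_bigr => b _.
rewrite !det_set_row mulrC !mxE.
by congr (_ * _); apply: eq_bigr => c _; rewrite !mxE.
Qed.

End RowReplacement.

(** * The Fischer pairing of polynomials *)

Section Pairing.
Variable d : nat.
Local Notation P := {mpoly int[d]}.
Implicit Types f g : P.

(** The constant term of f(d/dx) g. *)
Definition fischer f g : int :=
  \sum_(mu <- msupp f) f@_mu * (mderivm mu g)@_0.

(** Linearity in the first argument needs a summation range that does not
depend on the support of that argument. *)
Lemma fischerwE f g k : (msize f <= k)%N ->
  fischer f g = \sum_(mu : 'X_{1..d < k}) f@_mu * (mderivm mu g)@_0.
Proof.
move=> le_fk; pose I : subFinType _ := 'X_{1..d < k}.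
rewrite /fischer (big_mksub I) /=; first last.
- by move=> x /msize_mdeg_lt/leq_trans/(_ le_fk).
- by rewrite msupp_uniq.
rewrite big_rmcond //= => j /memN_msupp_eq0 ->.
by rewrite mul0r.
Qed.

Lemma fischer_is_linear_l g : linear_for *%R (fun f => fischer f g).
Proof.
move=> a p q; pose k := maxn (msize (a *: p + q)) (maxn (msize p) (msize q)).
rewrite !(@fischerwE _ _ k) /k ?leq_max ?leqnn ?orbT //.
rewrite big_distrr -big_split; apply: eq_bigr => mu _ /=.
by rewrite mcoeffD mcoeffZ mulrDl mulrA.
Qed.

Lemma fischer_is_linear_r f : linear_for *%R (fischer f).
Proof.
move=> a p q; rewrite /fischer big_distrr -big_split; apply: eq_bigr => mu _ /=.
by rewrite mderivmD mderivmZ mcoeffD mcoeffZ mulrDr mulrCA.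
Qed.

HB.instance Definition _ f :=
  GRing.isLinear.Build int P int *%R (fischer f) (fischer_is_linear_r f).

(** The pairing with swapped arguments, to which a linear structure in the
first argument can be attached. *)
Definition fischer_rev g f := fischer f g.
HB.instance Definition _ g :=
  GRing.isLinear.Build int P int *%R (fischer_rev g) (fischer_is_linear_l g).

Lemma fischer_suml I (r : seq I) (Q : pred I) (F : I -> P) g :
  fischer (\sum_(i <- r | Q i) F i) g = \sum_(i <- r | Q i) fischer (F i) g.
Proof. exact: (raddf_sum (fischer_rev g)). Qed.

Lemma fischerZl a f g : fischer (a *: f) g = a * fischer f g.
Proof. exact: (linearZ_LR (fischer_rev g)). Qed.

Lemma fischer11 : fischer 1 1 = 1.
Proof.
by rewrite /fischer msupp1 big_seq1 mderivm0m !mcoeff1 eqxx mulr1.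
Qed.

(** The property for which the pairing is introduced: a variable on the left
becomes a derivation on the right, so that differential operators can be
handled as polynomials. *)
Lemma fischer_adjoint (i : 'I_d) f g :
  fischer ('X_i * f) g = fischer f (mderiv i g).
Proof.
rewrite [f]mpolyE big_distrr /= !fischer_suml; apply: eq_bigr => mu _.
rewrite -scalerAr !fischerZl; congr (_ * _).
rewrite -mpolyXD /fischer !msuppX !big_seq1 !mcoeffX !eqxx !mul1r.
by rewrite mderivmDm mderivmU1m.
Qed.

Lemma mderiv_prod (i : 'I_d) N (F : 'I_N.+1 -> P) :
  mderiv i (\prod_t F t) = \sum_s mderiv i (F s) * \prod_(t < N) F (lift s t).
Proof.
elim: N F => [|N IHN] F.
  by rewrite big_ord_recl !big_ord0 big_ord_recl !big_ord0 !mulr1 addr0.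
rewrite big_ord_recl mderivM [RHS]big_ord_recl; congr (_ + _).
rewrite IHN big_distrr /=; apply: eq_bigr => s _.
rewrite [in RHS]big_ord_recl mulrCA; congr (_ * (_ * _)).
  by congr F; apply: val_inj.
by apply: eq_bigr => t _; congr F; apply: val_inj; rewrite /= /bump ltnS addnCA.
Qed.

(** The Laplace expansion of a permanent along its first row. *)
Lemma sum_perm_expand (R : comPzRingType) N (M : 'I_N.+1 -> 'I_N.+1 -> R) :
  \sum_(p : 'S_N.+1) \prod_t M t (p t) =
  \sum_s M ord0 s * \sum_(p : 'S_N) \prod_t M (lift ord0 t) (lift s (p t)).
Proof.
pose h (x : 'I_N.+1 * 'S_N) := lift_perm ord0 x.1 x.2.
have h_inj : injective h.
  move=> [s p] [s' p'] /permP eq_h.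
  have := eq_h ord0; rewrite !lift_perm_id /= => eq_s; rewrite -{}eq_s in eq_h *.
  congr (_, _); apply/permP => t; have := eq_h (lift ord0 t).
  by rewrite !lift_perm_lift => /lift_inj.
have h_bij : bijective h.
  by apply: inj_card_bij => //; rewrite card_prod card_ord !card_Sn factS.
rewrite (reindex h) /=; last exact: onW_bij.
under [RHS]eq_bigr do rewrite big_distrr /=.
rewrite pair_big /=; apply: eq_bigr => -[s p] _ /=.
rewrite big_ord_recl lift_perm_id; congr (_ * _).
by apply: eq_bigr => t _; rewrite lift_perm_lift.
Qed.

(** Pairing off the variables of the left product one at a time, each of them
differentiates away one equal variable of the right product. *)
Lemma fischer_prodX N (u v : 'I_N -> 'I_d) :
  fischer (\prod_t 'X_(u t)) (\prod_t 'X_(v t)) =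
  \sum_(p : 'S_N) \prod_t (u t == v (p t))%:R.
Proof.
elim: N u v => [|N IHN] u v.
  rewrite !big_ord0 fischer11 (big_pred1 1%g) ?big_ord0 // => p.
  by apply/esym/eqP/permP => -[].
rewrite (sum_perm_expand (fun s t => (u s == v t)%:R)).
rewrite [X in fischer X]big_ord_recl.
rewrite fischer_adjoint mderiv_prod raddf_sum /=; apply: eq_bigr => s _.
rewrite -(IHN (fun t => u (lift ord0 t)) (fun t => v (lift s t))).
have -> : mderiv (u ord0) 'X_(v s) = ((u ord0 == v s)%:R : int)%:MP.
  rewrite mderivX mnm1E eq_sym; case: eqP => [->|_]; last by rewrite scale0r mpolyC0.
  rewrite scale1r mpolyC1 -mpolyX0; congr 'X_[_]; apply/mnmP => j.
  by rewrite mnmBE subnn mnm0E.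
by rewrite mul_mpolyC linearZ_LR.
Qed.

End Pairing.

(** * Cayley's identity *)

Section Derivations.
Variables d m : nat.
Local Notation P := {mpoly int[d]}.

Lemma mderiv_nat i b : @mderiv d int i (b%:R) = 0.
Proof. by rewrite -mpolyC_nat mderivC. Qed.

Lemma mderiv_exp i (f : P) s :
  mderiv i (f ^+ s) = s%:R * f ^+ s.-1 * mderiv i f.
Proof.
elim: s => [|s IHs]; first by rewrite expr0 (mderiv_nat _ 1) !mul0r.
rewrite exprS mderivM IHs /=; case: s {IHs} => [|s].
  by rewrite /= expr0 !(mul0r, mulr0, mulr1, addr0, mul1r).
by rewrite /= exprS -[s.+2]addn1 natrD; ring.
Qed.

(** The Leibniz rule for f ^ s * M, summed over several derivations at once:
the terms that differentiate f recombine to s copies of f ^ s * M', and those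
that differentiate M give one copy each. *)
Lemma sum_mderiv_mulX (I : finType) (Q : pred I) (e : I -> bool) (x : I -> 'I_d)
    (M : I -> P) (f M' : P) s :
    (forall b, Q b -> (-1) ^+ e b * mderiv (x b) (M b) = M') ->
    \sum_(b | Q b) (-1) ^+ e b * (mderiv (x b) f * M b) = f * M' ->
  \sum_(b | Q b) (-1) ^+ e b * mderiv (x b) (f ^+ s * M b) =
  (s + #|Q|)%:R * (f ^+ s * M').
Proof.
move=> dM df.
transitivity (\sum_(b | Q b) (s%:R * f ^+ s.-1 *
    ((-1) ^+ e b * (mderiv (x b) f * M b)) + f ^+ s * M')).
  by apply: eq_bigr => b /dM <-; rewrite mderivM mderiv_exp; ring.
rewrite big_split /= -big_distrr /= df sumr_const natrD -[_ *+ _]mulr_natl.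
case: s => [|s]; first by rewrite !(mul0r, add0r) expr0 !mul1r mulr_natl.
by rewrite /= exprSr; ring.
Qed.

(** Only the entry (k, j) depends on the variable i, and the determinant is
affine in that entry with the cofactor as slope. *)
Lemma mderiv_det (A : 'M[P]_m) k j i :
  (forall a c, mderiv i (A a c) = ((a == k) && (c == j))%:R) ->
  mderiv i (\det A) = cofactor A k j.
Proof.
move=> dA; have dcof c : mderiv i (cofactor A k c) = 0.
  rewrite expand_cofactor raddf_sum big1 // => s _.
  rewrite /= mderivM [X in _ + _ * X](_ : _ = 0) ?mulr0 ?addr0.
    by case: (odd_perm s); rewrite ?expr0 ?expr1 ?mderivN (mderiv_nat _ 1) ?oppr0 mul0r.
  apply: (big_ind (fun f => mderiv i f = 0)).
  - exact: (mderiv_nat _ 1).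
  - by move=> f g df dg; rewrite mderivM df dg mul0r mulr0 addr0.
  - by move=> a ka; rewrite dA eq_sym (negbTE ka).
have dterm c : mderiv i (A k c * cofactor A k c) = (c == j)%:R * cofactor A k c.
  move: (cofactor A k c) (dcof c) (dA k c) => g dg; rewrite eqxx /= => <-.
  by rewrite mderivM dg mulr0 addr0.
rewrite (expand_det_row _ k).
transitivity (\sum_c (c == j)%:R * cofactor A k c).
  rewrite -(eq_bigr _ (fun c _ => dterm c)); exact: raddf_sum.
rewrite (bigD1 j) //= eqxx mul1r big1 ?addr0 // => c /negbTE ->.
by rewrite mul0r.
Qed.

End Derivations.

Section Cayley.
Variable m : nat.
Local Notation P := {mpoly int[m * m]}.
Local Notation D i j := (@mderiv (m * m) int (mxvec_index i j)).

Definition generic_mx : 'M[P]_m := \matrix_(i, j) 'X_(mxvec_index i j).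
Local Notation X := generic_mx.
Local Notation Delta := (\det X).

(** Its determinant is the minor of X on the first k rows and the columns
J 0, ..., J (k-1).  Filling up with unit rows keeps all the minors in the same
dimension, so that the induction on k needs no submatrices. *)
Definition head_minor_mx k (J : 'S_m) : 'M[P]_m :=
  \matrix_(a, c) if (a < k)%N then X a (J c) else (a == c)%:R.
Definition unit_rows_mx k (J : 'S_m) : 'M[P]_m :=
  \matrix_(a, c) if (a < k)%N then (c == J a)%:R else X a c.

Lemma mxvec_index_eq (i j k l : 'I_m) :
  (mxvec_index i j == mxvec_index k l) = (i == k) && (j == l).
Proof.
have [h hK Kh] := curry_mxvec_bij m m.
apply/eqP/andP => [e|[/eqP -> /eqP ->]] //.
have := hK (i, j) isT; rewrite /= e (hK (k, l) isT) => -[-> ->].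
by rewrite !eqxx.
Qed.

Lemma mderiv_generic k j a c : D k j (X a c) = ((a == k) && (c == j))%:R.
Proof.
rewrite mxE mderivX mnm1E mxvec_index_eq; case: andP => [[/eqP-> /eqP->]|_].
  rewrite scale1r -mpolyX0; congr 'X_[_]; apply/mnmP => i.
  by rewrite mnmBE subnn mnm0E.
by rewrite scale0r.
Qed.

(** Expansion along row k.  Bringing the chosen column b to the last place k
is the column transposition (b k), hence the change of J and the sign; the
columns beyond k contribute nothing, as two rows become equal. *)
Lemma det_head_minor_mxS (k : 'I_m) (J : 'S_m) :
  \det (head_minor_mx k.+1 J) = \sum_(b : 'I_m | (b <= k)%N)
     (-1) ^+ tperm b k * (X k (J b) * \det (head_minor_mx k (tperm b k * J))).
Proof.
rewrite (expand_det_row _ k) [LHS](bigID (fun b : 'I_m => (b <= k)%N)) /=.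
rewrite [Y in _ + Y]big1 ?addr0 => [|b]; last first.
  rewrite -ltnNge => kb; rewrite cofactor_set_row.
  have bk : b != k by rewrite -val_eqE gtn_eqF.
  rewrite (determinant_alternate bk) ?mulr0 // => c.
  by rewrite !mxE eqxx (negbTE bk) [(_ < _)%N]ltnNge kb /= eq_sym.
apply: eq_bigr => b bk; rewrite mxE ltnS leqnn [RHS]mulrCA; congr (_ * _).
rewrite -det_col_perm cofactor_set_row; congr (\det _).
apply/matrixP => a c; rewrite !mxE permM tpermK ltnS.
case: eqP => [->|/eqP ak].
  have k_eq c' : (k == tperm b k c') = (c' == b).
    by rewrite -{1}(tpermL b k) (can_eq (tpermK b k)) eq_sym.
  by rewrite ltnn k_eq.
rewrite leq_eqVlt val_eqE (negbTE ak) /=; case: ltnP => // ka.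
have ab : a != b.
  by apply: contraNneq ak => ab; rewrite -val_eqE eqn_leq ka andbT ab.
have <- : tperm b k a = a by rewrite tpermD // eq_sym.
by rewrite (can_eq (tpermK _ _)) tpermD // eq_sym.
Qed.

Lemma det_unit_rows_mxS (k : 'I_m) (J : 'S_m) :
  \det (unit_rows_mx k.+1 J) = cofactor (unit_rows_mx k J) k (J k).
Proof.
rewrite cofactor_set_row; congr (\det _); apply/matrixP => a c.
rewrite !mxE ltnS leq_eqVlt val_eqE.
by case: eqP => [->|].
Qed.

Lemma det_unit_rows_mx_tperm (k b : 'I_m) (J : 'S_m) : (b <= k)%N ->
  \det (unit_rows_mx k.+1 (tperm b k * J)) =
  (-1) ^+ tperm b k * \det (unit_rows_mx k.+1 J).
Proof.
move=> bk; rewrite -det_row_perm; congr (\det _); apply/matrixP => a c.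
rewrite !mxE permM; have -> // : (tperm b k a < k.+1)%N = (a < k.+1)%N.
  by case: tpermP => [->|->|//]; rewrite !ltnS bk leqnn.
by case: tpermP => // ->; rewrite // ?ltnS ?leqnn ?bk.
Qed.

(** The exchange relation for X and the matrix with k+1 unit rows: exchanging
a row b <= k puts a unit vector into X, which gives a cofactor of X, and
exchanging a row b > k puts into X a second copy of its row b. *)
Lemma det_unit_rows_mx_exchange (k : 'I_m) (J : 'S_m) :
  \sum_(b : 'I_m | (b <= k)%N) (-1) ^+ tperm b k *
     (cofactor X k (J b) * \det (unit_rows_mx k (tperm b k * J))) =
  Delta * \det (unit_rows_mx k.+1 J).
Proof.
rewrite -(det_exchange X _ k) [RHS](bigID (fun b : 'I_m => (b <= k)%N)) /=.
rewrite [Y in _ + Y]big1 ?addr0 => [|b]; last first.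
  rewrite -ltnNge => kb.
  have bk : b != k by rewrite -val_eqE gtn_eqF.
  rewrite (determinant_alternate bk) ?mul0r // => c.
  by rewrite !mxE eqxx (negbTE bk) [(_ < _)%N]ltnNge kb.
apply: eq_bigr => b bk; rewrite mulrCA; congr (_ * _).
  rewrite cofactor_set_row; congr (\det _); apply/matrixP => a c.
  by rewrite !mxE ltnS bk.
rewrite -det_row_perm; congr (\det _); apply/matrixP => a c; rewrite !mxE permM tpermK.
rewrite ltnS; have [->|ab] := eqVneq a b; first by rewrite tpermL ltnn.
have [ak|ak] := eqVneq a k.
  have ltbk : (b < k)%N by rewrite ltn_neqAle bk andbT val_eqE eq_sym -ak.
  by rewrite ak tpermR leqnn ltbk.
by rewrite [(a <= k)%N]leq_eqVlt val_eqE (negbTE ak) tpermD // eq_sym.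
Qed.

Lemma fischer_signl (b : bool) (f g : P) :
  fischer ((-1) ^+ b * f) g = (-1) ^+ b * fischer f g.
Proof. by rewrite !mulr_sign; case: b => //; apply: (raddfN (fischer_rev g)). Qed.

Lemma fischer_signr (b : bool) (f g : P) :
  fischer f ((-1) ^+ b * g) = (-1) ^+ b * fischer f g.
Proof. by rewrite !mulr_sign; case: b => //; apply: raddfN. Qed.

Lemma fischer_natr (n : nat) (f g : P) : fischer f (n%:R * g) = n%:R * fischer f g.
Proof. by rewrite !mulr_natl raddfMn. Qed.

(** The partial Cayley identity: the minor of d/dx on the first k rows, applied
to (det X)^(s+1), is (s+1) ... (s+k) (det X)^s times det X with the first k rows
replaced by unit vectors.  The next row contributes the factor s+1+k: a part s
from differentiating (det X)^s, by the exchange relation, and a part 1 from each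
of the k+1 terms of the expansion of the minor. *)
Lemma fischer_head_minor s k (J : 'S_m) (f : P) : (k <= m)%N ->
  fischer (\det (head_minor_mx k J) * f) (Delta ^+ s.+1) =
  (\prod_(a < k) (s.+1 + a)%:R) * fischer f (Delta ^+ s * \det (unit_rows_mx k J)).
Proof.
elim: k J f => [|k IHk] J f le_km.
  have -> : head_minor_mx 0 J = 1%:M by apply/matrixP => a c; rewrite !mxE.
  have -> : unit_rows_mx 0 J = X by apply/matrixP => a c; rewrite !mxE.
  by rewrite det1 big_ord0 !mul1r exprSr.
pose k' := Ordinal le_km.
rewrite (det_head_minor_mxS k') big_distrl /= fischer_suml.
have dDelta b : D k' (J b) Delta = cofactor X k' (J b).
  by apply: mderiv_det => a c; apply: mderiv_generic.
have dunit (b : 'I_m) : (b <= k)%N -> (-1) ^+ tperm b k' *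
    D k' (J b) (\det (unit_rows_mx k (tperm b k' * J))) = \det (unit_rows_mx k.+1 J).
  move=> bk; rewrite (@mderiv_det _ _ _ k' (J b)); last first.
    move=> a c; rewrite mxE; case: ltnP => [ak|ka]; last exact: mderiv_generic.
    by rewrite mderiv_nat; case: eqP ak => // ->; rewrite ltnn.
  have := @det_unit_rows_mxS k' (tperm b k' * J); rewrite permM tpermR => <-.
  by rewrite det_unit_rows_mx_tperm // mulrA -signr_addb addbb mul1r.
transitivity (\prod_(a < k) (s.+1 + a)%:R * fischer f
  (\sum_(b < m | (b <= k)%N) (-1) ^+ tperm b k' *
     D k' (J b) (Delta ^+ s * \det (unit_rows_mx k (tperm b k' * J))))).
  rewrite raddf_sum big_distrr /=; apply: eq_bigr => b bk.
  rewrite -!mulrA fischer_signl fischer_signr [RHS]mulrCA; congr (_ * _).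
  rewrite [Y in fischer Y]mulrCA IHk; last exact: ltnW.
  by congr (_ * _); rewrite mxE; apply: fischer_adjoint.
rewrite (sum_mderiv_mulX (e := fun b => tperm b k') _ dunit); last first.
  by rewrite -(det_unit_rows_mx_exchange k'); apply: eq_bigr => b _; rewrite dDelta.
rewrite fischer_natr mulrA big_ord_recr /=; congr (_ * _%:R * _).
rewrite -sum1_card (eq_bigl (fun b : 'I_m => (b < k.+1)%N)) //.
by rewrite (big_ord_narrow le_km) sum_nat_const card_ord muln1 addnS.
Qed.

(** For k = m the minor is det(d/dx) and all rows are unit vectors, which is
Cayley's identity; iterating it removes the factors det X one by one. *)
Lemma fischer_det_pow s :
  fischer (Delta ^+ s) (Delta ^+ s) = \prod_(i < s) \prod_(a < m) (i.+1 + a)%:R.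
Proof.
elim: s => [|s IHs]; first by rewrite !expr0 fischer11 big_ord0.
have head_full : head_minor_mx m 1 = X by apply/matrixP => a c; rewrite mxE ltn_ord perm1.
have unit_full : unit_rows_mx m 1 = 1%:M.
  by apply/matrixP => a c; rewrite !mxE ltn_ord perm1 eq_sym.
rewrite {1}exprS -{1}head_full fischer_head_minor // unit_full det1 mulr1 IHs.
by rewrite big_ord_recr mulrC.
Qed.

End Cayley.

(** * The constant of the first tableau *)

Section Grid.
Variables m n : nat.
Implicit Types (k l : 'I_(m * n)).

Lemma pos_rowK (i : 'I_m) (j : 'I_n) : pos_row (pos i j) = i.
Proof. by apply: val_inj; rewrite /= modnMDl modn_small. Qed.

Lemma pos_colK (i : 'I_m) (j : 'I_n) : pos_col (pos i j) = j.
Proof.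
apply: val_inj; have m_gt0 : (0 < m)%N by case: m i => // -[].
by rewrite /= divnMDl // divn_small ?addn0.
Qed.

Lemma posK k : pos (pos_row k) (pos_col k) = k.
Proof. by apply: val_inj; rewrite /= -divn_eq. Qed.

Lemma pos_eq k (i : 'I_m) (j : 'I_n) :
  (k == pos i j) = (pos_row k == i) && (pos_col k == j).
Proof.
apply/eqP/andP => [->|[/eqP <- /eqP <-]]; first by rewrite pos_rowK pos_colK.
by rewrite posK.
Qed.

Lemma pos_bij : bijective (fun k => (pos_row k, pos_col k)).
Proof.
by exists (fun x => pos x.1 x.2) => [k|[i j]] /=; rewrite ?posK // pos_rowK pos_colK.
Qed.

Lemma pos_bijC : bijective (fun k => (pos_col k, pos_row k)).
Proof.
by exists (fun x => pos x.2 x.1) => [k|[i j]] /=; rewrite ?posK // pos_rowK pos_colK.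
Qed.

Definition col_pres (s : 'S_(m * n)) := [forall k, pos_col (s k) == pos_col k].
Definition row_pres (s : 'S_(m * n)) := [forall k, pos_row (s k) == pos_row k].

Lemma tab_minors_first (R : comPzRingType) (A : 'M[R]_(m * n, m)) s :
  tab_minors A (map_mx s (first_tab m n)) =
  \sum_(p | col_pres p) (-1) ^+ p * \prod_k A (s k) (pos_row (p k)).
Proof.
rewrite /tab_minors (prod_det_perm _ pos_bij); apply: eq_bigr => p _.
by congr (_ * _); apply: eq_bigr => k _; rewrite !mxE posK.
Qed.

Lemma tab_minors_firstT (R : comPzRingType) (B : 'M[R]_(m * n, n)) s :
  tab_minors B (map_mx s (first_tab m n)^T) =
  \sum_(q | row_pres q) (-1) ^+ q * \prod_k B (s k) (pos_col (q k)).
Proof.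
rewrite /tab_minors (prod_det_perm _ pos_bijC); apply: eq_bigr => p _.
by congr (_ * _); apply: eq_bigr => k _; rewrite !mxE posK.
Qed.

(** Where a box is sent when p, which preserves columns, determines its new row
and q, which preserves rows, its new column. *)
Definition box_map (p q : 'S_(m * n)) k := pos (pos_row (p k)) (pos_col (q k)).

(** The determinant is the sign of [box_map p q] when this map is a bijection
of the boxes, and 0 otherwise. *)
Definition kappa_first : int :=
  \sum_(p | col_pres p) \sum_(q | row_pres q)
    (-1) ^+ p * (-1) ^+ q * \det (colsub (box_map p q) 1%:M).

Lemma sum_sign_colsub (R : comPzRingType) N (h : 'I_N -> 'I_N) (M : 'M[R]_N) :
  \sum_(s : 'S_N) (-1) ^+ s * \prod_k M (s k) (h k) =
  \det (colsub h 1%:M) * \det M.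
Proof.
transitivity (\det (colsub h M)^T).
  by apply: eq_bigr => s _; congr (_ * _); apply: eq_bigr => k _; rewrite !mxE.
rewrite det_tr mulrC -det_mulmx; congr (\det _); apply/matrixP => i j.
rewrite !mxE (bigD1 (h j)) //= !mxE eqxx mulr1 big1 ?addr0 // => l /negbTE lh.
by rewrite !mxE lh mulr0.
Qed.

(** The coefficient is an integer since it comes from the 0-1 matrices of the
maps [box_map p q] alone: the sum over s for a fixed pair p, q is the
determinant of the amalgam with its columns rearranged by this map. *)
Lemma kappa_firstE (R : comPzRingType) (A : 'M[R]_(m * n, m)) (B : 'M[R]_(m * n, n)) :
  kappa_first%:~R * \det (amalgam A B) =
  \sum_(s : 'S_(m * n)) (-1) ^+ s * tab_minors A (map_mx s (first_tab m n))
                          * tab_minors B (map_mx s (first_tab m n)^T).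
Proof.
rewrite /kappa_first rmorph_sum big_distrl /=.
under eq_bigr do rewrite rmorph_sum big_distrl /=.
under [RHS]eq_bigr => s _ do
  rewrite tab_minors_first tab_minors_firstT -mulrA big_distrl /= big_distrr /=.
rewrite [RHS]exchange_big /=; apply: eq_bigr => p _.
under [RHS]eq_bigr => s _ do rewrite big_distrr /= big_distrr /=.
rewrite [RHS]exchange_big /=; apply: eq_bigr => q _.
rewrite !rmorphM /= !rmorph_sign -det_map_mx map_mxsub map_mx1 -mulrA.
rewrite -sum_sign_colsub big_distrr; apply: eq_bigr => s _ /=.
have -> : \prod_k amalgam A B (s k) (box_map p q k) =
   (\prod_k A (s k) (pos_row (p k))) * \prod_k B (s k) (pos_col (q k)).
  by rewrite -big_split; apply: eq_bigr => k _; rewrite !mxE /box_map pos_rowK pos_colK.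
move: (\prod_k A _ _) (\prod_k B _ _) ((-1) ^+ s) ((-1) ^+ p) ((-1) ^+ q).
by move=> a b es ep eq; ring.
Qed.

Lemma det_exp_perm (R : comPzRingType) (M : 'M[R]_m) :
  \det M ^+ n = \sum_(p | col_pres p) (-1) ^+ p *
    \prod_(k < m * n) M (pos_row k) (pos_row (p k)).
Proof.
have := prod_det_perm (fun=> M) pos_bij.
by rewrite prodr_const card_ord.
Qed.

(** With q divided out, [box_map p q] preserves columns, and the Leibniz sum of
its matrix runs over the column-preserving p' that agree with it. *)
Lemma det_box_map p q :
  \det (colsub (box_map p q) 1%:M) = (-1) ^+ q *
    \sum_(p' | col_pres p') (-1) ^+ p' *
      \prod_k (pos_row (p' (q k)) == pos_row (p k))%:R :> int.
Proof.
pose b k := pos (pos_row (p (q^-1 k)%g)) (pos_col k).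
have -> : colsub (box_map p q) 1%:M = col_perm q (colsub b 1%:M) :> 'M[int]_(m * n).
  by apply/matrixP => k l; rewrite !mxE /b permK.
rewrite det_col_perm -det_tr; congr (_ * _).
rewrite [RHS]big_mkcond; apply: eq_bigr => p' _.
have bE k : (colsub b 1%:M)^T k (p' k) =
    ((pos_row (p' k) == pos_row (p (q^-1 k)%g)) &&
     (pos_col (p' k) == pos_col k))%:R :> int.
  by rewrite !mxE pos_eq.
under eq_bigr do rewrite bE.
case: (boolP (col_pres p')) => [/forallP cp'|].
  rewrite (reindex_perm q); congr (_ * _).
  by apply: eq_bigr => k _; rewrite permK cp' andbT.
rewrite negb_forall => /existsP[k ck].
by rewrite (bigD1 k) //= (negbTE ck) andbF mul0r mulr0.
Qed.

(** In the pairing of the expanded powers, a bijection matching the variables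
of two monomials must respect the first index of each x_ij, the row of the box:
it is the permutation q of the definition of [kappa_first]. *)
Lemma kappa_first_fischer :
  kappa_first = fischer (\det (generic_mx m) ^+ n) (\det (generic_mx m) ^+ n).
Proof.
set D := \det _.
have Dn : D ^+ n = \sum_(p | col_pres p) (-1) ^+ p *
    \prod_k 'X_(mxvec_index (pos_row k) (pos_row (p k))).
  rewrite /D det_exp_perm.
  by apply: eq_bigr => p _; congr (_ * _); apply: eq_bigr => k _; rewrite mxE.
rewrite Dn fischer_suml; apply: eq_bigr => p _.
rewrite raddf_sum /=.
under [RHS]eq_bigr => p' _ do
  rewrite fischer_signl fischer_signr fischer_prodX !big_distrr /=.
rewrite [RHS]exchange_big [LHS]big_mkcond /=; apply: eq_bigr => q _.
case: ifP => [/forallP rq|/negbT].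
  rewrite det_box_map mulrA -[_ * _ * (-1) ^+ q]mulrA -signr_addb addbb mulr1.
  rewrite big_distrr; apply: eq_bigr => p' _ /=; congr (_ * (_ * _)).
  by apply: eq_bigr => k _; rewrite mxvec_index_eq [pos_row k == _]eq_sym rq eq_sym.
rewrite negb_forall => /existsP[k rk].
rewrite big1 // => p' _; rewrite (bigD1 k) //= mxvec_index_eq eq_sym (negbTE rk).
by rewrite mul0r !mulr0.
Qed.

Lemma kappa_first_prod :
  kappa_first = \prod_(i < n) \prod_(a < m) (i.+1 + a)%:R.
Proof. by rewrite kappa_first_fischer fischer_det_pow. Qed.

Lemma kappa_first_neq0 : kappa_first != 0.
Proof.
rewrite kappa_first_prod; apply/prodf_neq0 => i _; apply/prodf_neq0 => a _.
by rewrite addSn pnatr_eq0.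
Qed.

End Grid.

(** * Hook lengths of a rectangle *)

Section Hooks.
Variables m n : nat.

Lemma prod_rising i : (i`! * \prod_(a < m) (i.+1 + a) = (m + i)`!)%N.
Proof.
elim: m => [|m' IHm]; first by rewrite big_ord0 muln1.
by rewrite big_ord_recr /= mulnA IHm addSn [(i + m')%N]addnC mulnC.
Qed.

Lemma hook_constE : hook_const m n = (kappa_first m n)%:~R.
Proof.
rewrite kappa_first_prod rmorph_prod; apply: eq_bigr => i _ /=.
rewrite -natr_prod rmorph_nat -(prod_rising i) natrM mulrAC divff ?mul1r //.
by rewrite pnatr_eq0 -lt0n fact_gt0.
Qed.

Lemma card_rev_ord_le N (j : 'I_N) : #|[set x : 'I_N | (rev_ord j <= x)%N]| = j.+1.
Proof.
have -> : [set x : 'I_N | (rev_ord j <= x)%N] =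
    [set rev_ord x | x : 'I_N in [set x : 'I_N | (x <= j)%N]].
  apply/setP => x; rewrite inE -[x in RHS]rev_ordK mem_imset; last exact: rev_ord_inj.
  by rewrite inE /=; have := ltn_ord x; have := ltn_ord j; lia.
rewrite card_imset; last exact: rev_ord_inj.
rewrite cardsE -sum1_card (eq_bigl (fun x : 'I_N => (x < j.+1)%N)) //.
by rewrite (big_ord_narrow (ltn_ord j)) sum_nat_const card_ord muln1.
Qed.

(** Counting boxes from the opposite corner makes arm and leg the coordinates
themselves. *)
Lemma hook_length_rev (i : 'I_m) (j : 'I_n) :
  hook_length (rev_ord i) (rev_ord j) = (j.+1 + i)%N.
Proof.
rewrite /hook_length.
set S := [set b | _].
have -> : S = [set (rev_ord i, x) | x in [set x : 'I_n | (rev_ord j <= x)%N]] :|: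
     [set (y, rev_ord j) | y in [set y : 'I_m | (rev_ord i <= y)%N] :\ rev_ord i].
  apply/setP => -[y x]; rewrite !inE /=; apply/idP/orP.
    case: (eqVneq y (rev_ord i)) => [-> /=|ny /=].
      case: leqP => [jx _|xj /=]; first by left; apply/imsetP; exists x; rewrite ?inE.
      by case: eqVneq => //= xj'; rewrite xj' ltnn in xj.
    case/andP => /eqP-> iy; right; apply/imsetP; exists y => //.
    by rewrite !inE ny.
  case=> /imsetP[z]; rewrite !inE => hz [-> ->]; first by rewrite eqxx hz.
  by case/andP: hz => _ hz; rewrite eqxx hz orbT.
rewrite cardsU !card_imset => [|y y' []|x x' []] //.
set I := _ :&: _; have -> : I = set0.
  apply/setP => -[y x]; rewrite !inE; apply/negP => /andP[/imsetP[z _ [-> _]]].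
  by case/imsetP => z'; rewrite !inE => /andP[/eqP ne _] [e _]; case: ne.
rewrite cards0 subn0 card_rev_ord_le; congr (_ + _)%N.
apply/eqP; rewrite -eqSS -(card_rev_ord_le i).
by rewrite [X in _ == X](cardsD1 (rev_ord i)) inE leqnn.
Qed.

Lemma prod_hook_length :
  (\prod_(i < m) \prod_(j < n) hook_length i j)%:R = (kappa_first m n)%:~R :> rat.
Proof.
rewrite kappa_first_prod exchange_big /= (reindex_inj rev_ord_inj) /=.
rewrite natr_prod rmorph_prod; apply: eq_bigr => j _ /=.
rewrite (reindex_inj rev_ord_inj) natr_prod rmorph_prod /=; apply: eq_bigr => i _.
by rewrite hook_length_rev rmorph_nat.
Qed.
End Hooks.

(** * Products of minors along arbitrary tableaux *)

Section TableauMaps.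
Variables N r c : nat.
Implicit Types g d : 'M['I_N]_(r, c).

Lemma tableau_inj g : is_tableau g -> injective (fun b : 'I_r * 'I_c => g b.1 b.2).
Proof.
move=> /forallP g_tab b b' eq_gb; have /cards1P[x Sx] := g_tab (g b.1 b.2).
have: b \in [set x] by rewrite -Sx inE.
have: b' \in [set x] by rewrite -Sx inE eq_gb.
by rewrite !inE => /eqP-> /eqP->.
Qed.

Lemma tableau_can g (h : 'I_N -> 'I_r * 'I_c) :
  cancel (fun b => g b.1 b.2) h -> cancel h (fun b => g b.1 b.2) -> is_tableau g.
Proof.
move=> gK hK; apply/forallP => l; apply/cards1P; exists (h l).
by apply/setP => b; rewrite !inE; apply/eqP/eqP => [<-|->]; [rewrite gK|exact: hK].
Qed.

Lemma in_common_colP g k l :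
  reflect (exists j i1 i2, g i1 j = k /\ g i2 j = l) (in_common_col g k l).
Proof.
apply: (iffP existsP) => [[j /andP[/existsP[i1 /eqP e1] /existsP[i2 /eqP e2]]]|].
  by exists j, i1, i2.
by case=> j [i1 [i2 [e1 e2]]]; exists j; apply/andP; split; apply/existsP;
   [exists i1|exists i2]; apply/eqP.
Qed.

(** Exchanging k and l swaps two rows in the minor of the column containing
both and leaves the other minors alone. *)
Lemma tab_minors_tperm (R : comPzRingType) (A : 'M[R]_(N, r)) g (s : 'S_N) k l :
    is_tableau g -> in_common_col g k l -> k != l ->
  tab_minors A (map_mx (tperm k l * s)%g g) = - tab_minors A (map_mx s g).
Proof.
move=> g_tab /in_common_colP[j [i1 [i2 [<- <-]]]] nkl.
have g_inj := tableau_inj g_tab.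
rewrite /tab_minors (bigD1 j) //= [in RHS](bigD1 j) //= -mulNr; congr (_ * _).
  rewrite -mulN1r.
  have ni : i1 != i2 by apply: contraNneq nkl => ->.
  have <- : (-1) ^+ tperm i1 i2 = -1 :> R by rewrite odd_tperm ni.
  rewrite -det_row_perm; congr (\det _); apply/matrixP => i c'.
  rewrite !mxE permM; congr (A (s _) _).
  case: (tpermP i1 i2 i) => [->|->|n1 n2]; rewrite ?tpermL ?tpermR //.
  by rewrite tpermD //; apply/eqP => /esym /(@g_inj (_, _) (_, _)) -[].
apply: eq_bigr => j' nj; congr (\det _); apply/matrixP => i c'.
rewrite !mxE permM; congr (A (s _) _).
by rewrite tpermD //; apply: contraNneq nj => /(@g_inj (_, _) (_, _)) [_ ->].
Qed.

(** The sign is the same for all rings, matrices and s, as kappa must not depend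
on them; it is given by the exponent e. *)
Lemma tab_minors_col_equiv g d : col_equiv g d ->
  exists e : nat, forall (R : comPzRingType) (A : 'M[R]_(N, r)) (s : 'S_N),
    tab_minors A (map_mx s d) = (-1) ^+ e * tab_minors A (map_mx s g).
Proof.
move=> /forallP gd.
have /fin_all_exists[t tP] : forall j, exists t : 'S_r, forall i, g i j = d (t i) j.
  move=> j; have /existsP[t /eqP/matrixP tP] := gd j.
  by exists t => i; have := tP i 0; rewrite !mxE.
exists (\sum_j (t j : nat))%N => R A s; rewrite -prodrXr -big_split /=.
apply: eq_bigr => j _.
have -> : rowsub (fun i => map_mx s g i j) A =
          row_perm (t j) (rowsub (fun i => map_mx s d i j) A).
  by apply/matrixP => i k; rewrite !mxE tP.
by rewrite det_row_perm mulrA -signr_addb addbb mul1r.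
Qed.

Lemma col_equiv_sub g d :
    (forall i j, exists i', g i j = d i' j) ->
    injective (fun b : 'I_r * 'I_c => g b.1 b.2) -> col_equiv g d.
Proof.
move=> gd g_inj; apply/forallP => j.
have [t tP] := fin_all_exists (gd^~ j).
have t_inj : injective t.
  by move=> i i' eq_t; have := tP i; rewrite eq_t -tP => /(@g_inj (_, _) (_, _)) -[].
apply/existsP; exists (perm t_inj); apply/eqP/matrixP => i k.
by rewrite !mxE permE tP.
Qed.

End TableauMaps.

Section Fayers.
Variables m n : nat.
Implicit Types g : 'M['I_(m * n)]_(m, n).

Lemma tableau_perm g :
  is_tableau g -> exists p : 'S_(m * n), map_mx p (first_tab m n) = g.
Proof.
move=> g_tab; pose f (k : 'I_(m * n)) := g (pos_row k) (pos_col k).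
have f_inj : injective f.
  move=> k l /(tableau_inj g_tab (x1 := (_, _)) (x2 := (_, _))).
  by move=> /(bij_inj (pos_bij _ _)).
exists (perm f_inj); apply/matrixP => i j.
by rewrite !mxE permE /f pos_rowK pos_colK.
Qed.

Lemma tab_sign_neq0 g : is_tableau g -> tab_sign g != 0.
Proof.
move=> /tableau_perm[p pg]; rewrite /tab_sign; case: pickP => [q _|/(_ p)].
  by rewrite signr_eq0.
by rewrite pg eqxx.
Qed.

Variables (alpha : 'M['I_(m * n)]_(m, n)) (beta : 'M['I_(m * n)]_(n, m)).
Hypotheses (alpha_tab : is_tableau alpha) (beta_tab : is_tableau beta).

Definition clash := [exists k, exists l,
  [&& k != l, in_common_col alpha k l & in_common_col beta k l]].

Lemma tableau_bij r c (d : 'M['I_(m * n)]_(r, c)) : (r * c = m * n)%N ->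
  is_tableau d ->
  exists h, cancel (fun b => d b.1 b.2) h /\ cancel h (fun b => d b.1 b.2).
Proof.
move=> rc /tableau_inj d_inj.
have [|h hK Kh] := inj_card_bij d_inj; first by rewrite card_prod !card_ord rc.
by exists h.
Qed.

(** A number is determined by its column in beta and its column in alpha, so
taking these two as its row and column places all numbers in the boxes. *)
Lemma no_clash_tableau : ~~ clash -> exists g,
  [/\ is_tableau g, col_equiv g alpha & col_equiv g^T beta].
Proof.
move=> no_clash.
have [a [aK Ka]] := tableau_bij erefl alpha_tab.
have [b [bK Kb]] := tableau_bij (mulnC n m) beta_tab.
pose f k := ((b k).2, (a k).2).
have f_inj : injective f.
  move=> k l [eb ea]; apply/eqP; apply: contraR no_clash => nkl.
  apply/existsP; exists k; apply/existsP; exists l; rewrite nkl /=.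
  apply/andP; split; apply/in_common_colP.
    by exists (a k).2, (a k).1, (a l).1; split; [exact: Ka|rewrite ea; exact: Ka].
  by exists (b k).2, (b k).1, (b l).1; split; [exact: Kb|rewrite eb; exact: Kb].
have [|h fK hK] := inj_card_bij f_inj; first by rewrite card_prod !card_ord.
pose g := \matrix_(i < m, j < n) h (i, j).
have gE (x : 'I_m * 'I_n) : g x.1 x.2 = h x by rewrite mxE -surjective_pairing.
have g_tab : is_tableau g.
  by apply: (@tableau_can _ _ _ _ f) => [x|k]; rewrite ?gE // hK.
exists g; split=> //; apply: col_equiv_sub.
- move=> i j; exists (a (h (i, j))).1; rewrite mxE -[LHS]Ka.
  by have /(congr1 snd) /= -> := hK (i, j).
- exact: tableau_inj.
- move=> j i; exists (b (h (i, j))).1; rewrite !mxE -[LHS]Kb.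
  by have /(congr1 fst) /= -> := hK (i, j).
- move=> [j i] [j' i']; rewrite !mxE /=.
  by move=> /(can_inj hK) [-> ->].
Qed.

Lemma fayers_eq0 : (fayers alpha beta == 0) = clash.
Proof.
rewrite /fayers -/clash; case: (boolP clash) => [_|no_clash]; first exact: eqxx.
case: pickP => [g /and3P[g_tab _ _]|nog]; first exact/negbTE/tab_sign_neq0.
have [g [g1 g2 g3]] := no_clash_tableau no_clash.
by have := nog g; rewrite g1 g2 g3.
Qed.

Definition signed_minor_sum (R : comPzRingType)
    (A : 'M[R]_(m * n, m)) (B : 'M[R]_(m * n, n)) : R :=
  \sum_(s : 'S_(m * n)) (-1) ^+ s * tab_minors A (map_mx s alpha)
                                  * tab_minors B (map_mx s beta).

(** The permutations s and (k l) s contribute opposite terms.  They are paired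
as an even and an odd one, because a sum equal to its opposite need not vanish
when 2 is not invertible. *)
Lemma signed_minor_sum_clash (R : comPzRingType)
    (A : 'M[R]_(m * n, m)) (B : 'M[R]_(m * n, n)) :
  clash -> signed_minor_sum A B = 0.
Proof.
case/existsP => k /existsP[l /and3P[nkl ka kb]].
rewrite /signed_minor_sum (bigID (fun s : 'S_(m * n) => odd_perm s)) /=.
rewrite (reindex_inj (mulgI (tperm k l))) /=.
have tau_odd (s : 'S_(m * n)) : (tperm k l * s)%g = ~~ s :> bool.
  by rewrite odd_permM odd_tperm nkl.
under eq_bigl do rewrite tau_odd.
rewrite -big_split big1 // => s es /=.
rewrite !(tab_minors_tperm _ _ _ _ nkl) // tau_odd (negbTE es) /=.
by rewrite mulrNN !(expr0, expr1, mulN1r, mul1r) mulrN addNr.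
Qed.

Lemma signed_minor_sum_no_clash : ~~ clash ->
  exists e : nat, forall (R : comPzRingType)
    (A : 'M[R]_(m * n, m)) (B : 'M[R]_(m * n, n)),
  signed_minor_sum A B = ((-1) ^+ e * kappa_first m n)%:~R * \det (amalgam A B).
Proof.
case/no_clash_tableau => g [/tableau_perm[p <-]].
move=> /tab_minors_col_equiv[ea eaP] /tab_minors_col_equiv[eb ebP].
exists (p + ea + eb)%N => R A B.
rewrite intrM -mulrA kappa_firstE rmorphXn rmorphN1 big_distrr /=.
rewrite [RHS](reindex_inj (mulgI p)) /=; apply: eq_bigr => s _.
have map_mx_perm r c (d : 'M['I_(m * n)]_(r, c)) :
    map_mx s (map_mx p d) = map_mx (p * s)%g d.
  by apply/matrixP => i j; rewrite !mxE permM.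
rewrite eaP ebP map_trmx !map_mx_perm.
rewrite !exprD odd_permM signr_addb.
have pp : (-1) ^+ p * (-1) ^+ p = 1 :> R by rewrite -signr_addb addbb.
move: (tab_minors A _) (tab_minors B _) ((-1) ^+ ea) ((-1) ^+ eb).
move: ((-1) ^+ p) pp ((-1) ^+ s) => ep pp es tA tB sa sb.
by rewrite -[LHS]mul1r -pp; ring.
Qed.
End Fayers.

Lemma first_tab_no_clash m n : ~~ clash (first_tab m n) (first_tab m n)^T.
Proof.
apply/existsP => -[k /existsP[l /and3P[nkl]]].
case/in_common_colP => j [i1 [i2 []]]; rewrite !mxE => ek el.
case/in_common_colP => i [j1 [j2 []]]; rewrite !mxE => ek' el'.
have eq_col : pos_col k = pos_col l by rewrite -ek -el !pos_colK.
have eq_row : pos_row k = pos_row l by rewrite -ek' -el' !pos_rowK.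
by case/eqP: nkl; rewrite -[k]posK -[l]posK eq_row eq_col.
Qed.

(** * Amalgams and products of minors *)

Theorem theorem3p8 (m n : nat) (m_gt0 : (0 < m)%N) (n_gt0 : (0 < n)%N)
    (alpha : 'M['I_(m * n)]_(m, n)) (beta : 'M['I_(m * n)]_(n, m))
    (alpha_std : is_standard alpha) (beta_std : is_standard beta) :
  exists kappa : int,
    [/\ forall (R : comPzRingType)
               (A : 'M[R]_(m * n, m)) (B : 'M[R]_(m * n, n)),
          kappa%:~R * \det (amalgam A B) =
          \sum_(sigma : 'S_(m * n))
             (-1) ^+ sigma * tab_minors A (map_mx sigma alpha)
                           * tab_minors B (map_mx sigma beta),
        kappa = 0 <-> fayers alpha beta = 0
      & alpha = first_tab m n -> beta = (first_tab m n)^T -> (n <= m)%N ->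
          kappa%:~R = hook_const m n
          /\ hook_const m n = (\prod_(i < m) \prod_(j < n) hook_length i j)%:R].
Proof.
case/and3P: alpha_std => alpha_tab _ _; case/and3P: beta_std => beta_tab _ _.
have fayersE := fayers_eq0 alpha_tab beta_tab.
have [cl|no_cl] := boolP (clash alpha beta).
  exists 0; split.
  - move=> R A B; rewrite mul0r.
    exact/esym/(signed_minor_sum_clash alpha_tab beta_tab).
  - by split=> // _; apply/eqP; rewrite fayersE.
  - by move=> ea eb; have := first_tab_no_clash m n; rewrite -eb -ea cl.
have fayers_neq0 : fayers alpha beta <> 0.
  by apply/eqP; rewrite fayersE.
have kappa_neq0 := kappa_first_neq0 m n.
have [/andP[/eqP ea /eqP eb]|not_first] :=
    boolP ((alpha == first_tab m n) && (beta == (first_tab m n)^T)).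
  exists (kappa_first m n); split.
  - by move=> R A B; rewrite kappa_firstE ea eb.
  - by split=> // k0; rewrite k0 eqxx in kappa_neq0.
  - by rewrite prod_hook_length hook_constE.
have [e eP] := signed_minor_sum_no_clash alpha_tab beta_tab no_cl.
exists ((-1) ^+ e * kappa_first m n); split.
- by move=> R A B; rewrite -eP.
- by split=> // /eqP; rewrite mulf_eq0 signr_eq0 (negbTE kappa_neq0).
- by move=> ea eb; rewrite ea eb !eqxx in not_first.
Qed.
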